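(* Let $E$ be a separable metrisable space that is a star convex set in a linear space with $x_0\in E$ as center, and let $d$ be a metric inducing the topology of $E$ such that $$d((1-\lambda)x_0+\lambda x,y)\le(1-\lambda)d(x_0,y)+\lambda d(x,y)\quad\text{for all }\lambda\in[0,1]\text{ and }x,y\in E.$$ Let $(I,\mathcal{I})$ be a non-empty measurable space, $(\Omega,\mathcal{F},\mathbb{P})$ a probability space and $X:I\times\Omega\to E$ be product measurable. Then there is a sequence $(\varphi_n)_{n\in\mathbb{N}}$ of $E$-valued Borel measurable maps on $E$ (not depending on $X$), each taking finitely many values, with $d(\varphi_k(x),x_0)\le d(x,x_0)$, $d(\varphi_{k+1}(x),x)\le d(\varphi_k(x),x)$ and $\lim_{n\uparrow\infty}\varphi_n(x)=x$ for all $k\in\mathbb{N}$ and $x\in E$, such that the sequence $(X^{(n)})_{n\in\mathbb{N}}$ of $E$-valued product measurable processes on $I\times\Omega$ given by $X^{(n)}_t:=\varphi_n(X_t)$ for all $n\in\mathbb{N}$ satisfies the following two properties: (i) For each $n\in\mathbb{N}$ there are $N_n\in\mathbb{N}$ and pairwise distinct $x_{1,n},\dots,x_{N_n,n}\in E$ such that $$X^{(n)}_t=\sum_{i=1}^{N_n}x_{i,n}\mathbf{1}_{B_{i,n}}(X_t)\quad\text{for all }t\in I$$ with the Borel sets $B_{i,n}:=\{x\in E\,|\,\varphi_n(x)=x_{i,n}\}$, where $i\in\{1,\dots,N_n\}$, that form a disjoint decomposition of $E$. (ii) $d(X^{(k)}_t,x_0)\le d(X_t,x_0)$ and $d(X^{(k+1)}_t,X_t)\le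 d(X^{(k)}_t,X_t)$ and $(X^{(n)}_t)_{n\in\mathbb{N}}$ converges pointwise to $X_t$ for any $k\in\mathbb{N}$ and $t\in I$.
   Context: Product measurable means measurable with respect to $\mathcal{I}\otimes\mathcal{F}$ and the Borel $\sigma$-field of $E$. A set $E$ in a linear space is star convex with center $x_0\in E$ if $(1-\lambda)x_0+\lambda x\in E$ for all $x\in E$ and $\lambda\in[0,1]$. *)

(* Defs.v *)
From HB Require Import structures.
From mathcomp Require Import all_boot all_order all_algebra.
From mathcomp Require Import all_classical all_reals all_analysis.

Set Implicit Arguments.
Unset Strict Implicit.
Unset Printing Implicit Defensive.

Import Order.TTheory GRing.Theory Num.Theory.

Local Open Scope classical_set_scope.
Local Open Scope ring_scope.

(* Measurable types are pointed in the library, so a metric space can carry its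
   Borel sigma-algebra only if it is pointed. The distinguished element merely
   witnesses nonemptiness. *)
#[short(type="pmetricType")]
HB.structure Definition PMetric (K : numDomainType) :=
  {T of PseudoPointedMetric K T & PseudoMetric_isMetric K T}.

Definition separable (T : topologicalType) : Prop :=
  exists2 D : set T, countable D & dense D.

Definition borel (T : ptopologicalType) := g_sigma_algebraType (@open T).

Definition star_convex (R : realType) (L : lmodType R) (A : set L) (x0 : L) :
    Prop :=
  A x0 /\
  forall (x : L) (l : R), A x -> 0 <= l <= 1 -> A ((1 - l) *: x0 + l *: x).

(* [iota] is the inclusion of the set [E] into its ambient linear space, hence
   [z] below is the point (1 - l) x0 + l x of [E]; it exists when the range of
   [iota] is star convex with center [iota x0]. *)
Definition dist_star_convex (R : realType) (L : lmodType R) (E : metricType R)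
    (iota : E -> L) (x0 : E) : Prop :=
  forall (l : R) (x y z : E), 0 <= l <= 1 ->
    iota z = (1 - l) *: iota x0 + l *: iota x ->
    mdist z y <= (1 - l) * mdist x0 y + l * mdist x y.

(* Main.v *)
(* Let c enumerate the points (1 - l) x0 + l e, where e runs through a countable
   dense set and l through the numbers 1 - 1/(m+1). Convexity of the metric
   allows any x to be approximated by points c_i with d(c_i, x0) <= d(x, x0):
   if e is very close to x, a slight contraction of e towards x0 is closer to x0
   than x is, and still close to x. Then phi_n(x) is x0 or one of those among
   c_0, ..., c_(n-1) that are no farther from x0 than x is, whichever comes
   closest to x, earlier points being preferred. *)
Require Import Defs.
From mathcomp Require Import all_boot all_order all_algebra.
From mathcomp Require Import all_classical all_reals all_analysis.
From mathcomp Require Import measurable_realfun lra.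

Import Order.TTheory GRing.Theory Num.Theory.
Import numFieldNormedType.Exports.

Local Open Scope classical_set_scope.
Local Open Scope ring_scope.

(** The start value [x0] is admissible for every [x]. Each stage tests one new point against the
    current best only, so the bounds below follow by induction or case analysis on a single
    comparison. *)
Fixpoint nearest_admissible {R : realType} {E : metricType R} (x0 : E)
    (c : nat -> E) (n : nat) (x : E) : E :=
  if n is m.+1 then
    let y := nearest_admissible x0 c m x in
    if (mdist (c m) x0 <= mdist x x0) && (mdist (c m) x < mdist y x)
    then c m else y
  else x0.

Section NearestAdmissible.
Context {R : realType} {E : metricType R} (x0 : E) (c : nat -> E).
Local Notation phi := (nearest_admissible x0 c).

Lemma nearest_admissible_center n x : mdist (phi n x) x0 <= mdist x x0.
Proof.
elim: n => [|n IHn] /=; first by rewrite mdistxx mdist_ge0.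
by case: ifP => // /andP[].
Qed.

Lemma nearest_admissible_closer n x :
  mdist (phi n.+1 x) x <= mdist (phi n x) x.
Proof. by rewrite /=; case: ifP => // /andP[_ /ltW]. Qed.

Lemma nearest_admissible_noninc m n x :
  (m <= n)%N -> mdist (phi n x) x <= mdist (phi m x) x.
Proof.
move=> /subnK <-; elim: (n - m)%N => [//|k IHk].
exact: le_trans (nearest_admissible_closer _ _) IHk.
Qed.

Lemma nearest_admissible_optimal n x : mdist (c n) x0 <= mdist x x0 ->
  mdist (phi n.+1 x) x <= mdist (c n) x.
Proof. by move=> /= ->; case: ltP. Qed.

(** Stage [n.+1] adds at most the value [c n]. *)
Lemma finite_range_nearest_admissible n : finite_set (range (phi n)).
Proof.
elim: n => [|n IHn].
  by apply: sub_finite_set (finite_set1 x0) => _ [x _ <-].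
apply: (@sub_finite_set _ _ (range (phi n) `|` [set c n])); last first.
  by rewrite finite_setU; split=> //; exact: finite_set1.
by move=> _ [x _ <-] /=; case: ifP => _; [right|left; exists x].
Qed.

(** One admissible [c n] within [e] of [x] suffices: it competes from stage [n.+1] on, and the
    distance to [x] never grows afterwards. *)
Lemma cvg_nearest_admissible :
  (forall x e, 0 < e -> exists n,
    mdist (c n) x0 <= mdist x x0 /\ mdist (c n) x < e) ->
  forall x, phi n x @[n --> \oo] --> x.
Proof.
move=> c_approx x; apply/metricType_numDomainType.cvgrPdist_lt => e e0.
have [n [cx0 cx]] := c_approx x e e0.
exists n.+1 => // k /= nk; rewrite metric_sym.
apply: le_lt_trans (nearest_admissible_noninc _ _ x nk) _.
exact: le_lt_trans (nearest_admissible_optimal _ _ cx0) cx.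
Qed.

End NearestAdmissible.

Lemma continuous_borel_measurable {R : realType} {T : ptopologicalType}
    (f : T -> R) :
  continuous f -> measurable_fun [set: borel T] (f : borel T -> R).
Proof.
move=> /continuousP cf.
apply: (measurability _ (RGenOInfty.measurableE R)) => _ [_ [a ->] <-].
rewrite setTI; apply: sub_sigma_algebra; apply: cf; exact: interval_open.
Qed.

Lemma continuous_mdist {R : realType} {E : metricType R} (y : E) :
  continuous (mdist y : E -> R).
Proof.
move=> x; apply/(@cvgrPdist_lt _ R) => e e0; near=> z.
have xz : mdist x z < e.
  by near: z; apply: metricType_numDomainType.cvgr_dist_lt.
rewrite ltr_distl ltrBlDr.
have := metric_triangle y x z; have := metric_triangle y z x.
rewrite (metric_sym z x); lra.
Unshelve. all: by end_near. Qed.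

(** This makes the level sets of a measurable map into [borel E] measurable. *)
Lemma measurable_borel_set1 {R : realType} {E : pmetricType R} (a : E) :
  measurable ([set a] : set (borel E)).
Proof.
rewrite -[X in measurable X]setCK; apply: measurableC.
apply: sub_sigma_algebra; apply: closed_openC.
exact/accessible_closed_set1/hausdorff_accessible/metric_hausdorff.
Qed.

(** The test at stage [n.+1] involves the distance [g n x] from [x] to a point that itself depends
    on [x]. Its measurability is therefore carried through the induction together with that of the
    map: both are glued from two measurable pieces along the same measurable test. *)
Lemma measurable_nearest_admissible {R : realType} {E : pmetricType R}
    (x0 : E) (c : nat -> E) (n : nat) :
  measurable_fun [set: borel E]
    (nearest_admissible x0 c n : borel E -> borel E).
Proof.
have mdist_measurable y : measurable_fun [set: borel E] (mdist y : borel E -> R).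
  by apply: continuous_borel_measurable; exact: continuous_mdist.
pose g k (x : borel E) : R := mdist (nearest_admissible x0 c k x) x.
suff : measurable_fun [set: borel E] (g n) /\ measurable_fun [set: borel E]
    (nearest_admissible x0 c n : borel E -> borel E) by case.
elim: n => [|n [mg mphi]]; first by split; [exact: mdist_measurable|exact: measurable_cst].
have mb : measurable_fun [set: borel E] (fun x : borel E =>
    (mdist (c n) x0 <= mdist x0 x) && (mdist (c n) x < g n x)).
  apply: measurable_and; first exact: measurable_fun_ler.
  exact: measurable_fun_ltr.
split.
  have -> : g n.+1 = fun x =>
      if (mdist (c n) x0 <= mdist x0 x) && (mdist (c n) x < g n x)
      then mdist (c n) x else g n x.
    by apply/funext => x; rewrite /g /= (metric_sym x x0); case: ifP.
  exact: measurable_fun_ifT.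
rewrite [X in measurable_fun _ X](_ : _ = fun x =>
    if (mdist (c n) x0 <= mdist x0 x) && (mdist (c n) x < g n x)
    then c n else nearest_admissible x0 c n x); last first.
  by apply/funext => x; rewrite /g /= (metric_sym x x0).
by apply: measurable_fun_ifT => //; exact: measurable_cst.
Qed.

(** Removing repetitions from a list of the values makes [a] injective; the point [t] shows that the
    list is nonempty. *)
Lemma finite_range_level_sets {T : Type} {U : choiceType} {f : T -> U} (t : T) :
  finite_set (range f) -> exists (N : nat) (a : 'I_N -> U),
    [/\ (0 < N)%N, injective a & forall x, exists i, f x = a i].
Proof.
move=> /finite_seqP[s fs].
have fsP x : f x \in undup s.
  by rewrite mem_undup; have : range f (f x) by []; rewrite fs.
exists (size (undup s)), (tnth (in_tuple (undup s))); split.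
- by have := fsP t; case: (undup s).
- by apply/tuple_uniqP; exact: undup_uniq.
- by move=> x; have /(tnthP (in_tuple _))[i ->] := fsP x; exists i.
Qed.

Lemma dense_admissible {R : realType} {L : lmodType R} {E : pmetricType R}
    {iota : E -> L} {x0 : E} :
  injective iota -> separable E -> star_convex (range iota) (iota x0) ->
  dist_star_convex iota x0 ->
  exists c : nat -> E, forall x e, 0 < e -> exists n,
    mdist (c n) x0 <= mdist x x0 /\ mdist (c n) x < e.
Proof.
move=> iota_inj [D cD dD] [_ E_star] dist_star.
have [d d_surj] := pcard_surjP cD.
(* [t m] is the weight that the contraction gives to [x0]. *)
pose t m : R := m.+1%:R^-1.
have t_gt0 m : 0 < t m by rewrite invr_gt0.
have t_le1 m : t m <= 1 by rewrite invf_le1// ler1n.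
have t01 m : 0 <= 1 - t m <= 1 by have := t_gt0 m; have := t_le1 m; lra.
have /choice[z zP] (jm : nat * nat) : exists z,
    iota z = (1 - (1 - t jm.2)) *: iota x0 + (1 - t jm.2) *: iota (d jm.1).
  have [|y _ <-] := E_star (iota (d jm.1)) (1 - t jm.2) _ (t01 _).
    by exists (d jm.1).
  by exists y.
(* The default [x0] fills the indices that code no pair; only codes of pairs are used below. *)
exists (fun n => odflt x0 (omap z (unpickle n))) => x e e0.
(* For [x = x0] only [x0] itself is admissible, so it must occur in the sequence. Otherwise [r] is
   positive, and so is the radius [delta]. *)
have [->|xx0] := eqVneq x x0.
  (* t 0 = 1, so that z (j, 0) is the center. *)
  exists (pickle (0, 0)%N); rewrite pickleK /=.
  have -> : z (0, 0)%N = x0; last by rewrite mdistxx.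
  by apply: iota_inj; rewrite zP /t invr1 subrr subr0 scale1r scale0r addr0.
have r0 : 0 < mdist x x0 by rewrite mdist_gt0.
set r := mdist x x0 in r0 *.
have [m tm] : exists m, r * t m < e / 2.
  have /ltr_add_invr[m] : 0 < e / 2 / r by rewrite !divr_gt0.
  rewrite add0r ltr_pdivlMr// => rm; exists m; by rewrite mulrC.
(* With this radius the overshoot is absorbed, as (1 - t) (1 + t) <= 1, and the distance to [x]
   stays below 2 r t < e. *)
pose delta := r * t m.
have delta0 : 0 < delta by rewrite mulr_gt0.
have [y [xy /d_surj[j _ yE]]] : ball x delta `&` D !=set0.
  (* Density is applied to an open set, the interior of the ball, which contains [x]. *)
  have [y [Bxy Dy]] : (ball x delta)° `&` D !=set0.
    apply: dD; last exact: open_interior.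
    by exists x; exact: nbhsx_ballx.
  by exists y; split=> //; exact: interior_subset Bxy.
have {}xy : mdist y x < delta by rewrite metric_sym; rewrite ballEmdist in xy.
exists (pickle (j, m)); rewrite pickleK /=.
have zyj := zP (j, m); rewrite /= yE in zyj.
have yx0 := metric_triangle y x x0; rewrite -/r in yx0.
have := dist_star _ _ x0 _ (t01 m) zyj.
have := dist_star _ _ x _ (t01 m) zyj.
rewrite mdistxx (metric_sym x0 x) -/r subKr mulr0 add0r => zx zx0.
(* With d(y, x) < r t, the contraction satisfies
   d(z, x0) <= (1 - t) (r + r t) <= r and d(z, x) <= t r + (1 - t) r t < e. *)
have := t_gt0 m; have := t_le1 m; rewrite /delta in delta0 xy.
move: (t m) => u in tm delta0 xy zx zx0 *; move=> u1 u0; split; nra.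
Qed.

Theorem corollary3p11 (R : realType) (L : lmodType R) (E : pmetricType R)
  (iota : E -> L) (x0 : E)
  (iota_inj : injective iota)
  (E_separable : separable E)
  (E_star : star_convex (range iota) (iota x0))
  (dist_star : dist_star_convex iota x0)
  (dI : measure_display) (I : measurableType dI)
  (dO : measure_display) (Omega : measurableType dO) (P : probability Omega R) :
  exists phi : nat -> E -> E,
    [/\ forall n, measurable_fun [set: borel E] (phi n : borel E -> borel E),
        forall n, finite_set (range (phi n)),
        forall k x, mdist (phi k x) x0 <= mdist x x0,
        forall k x, mdist (phi k.+1 x) x <= mdist (phi k x) x &
        forall x, phi n x @[n --> \oo] --> x] /\
    forall X : I * Omega -> E,
      measurable_fun [set: I * Omega] (X : I * Omega -> borel E) ->
      let Xn n (p : I * Omega) : E := phi n (X p) in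
      [/\ forall n,
            measurable_fun [set: I * Omega] (Xn n : I * Omega -> borel E),
          forall n, exists (N : nat) (a : 'I_N -> E),
            let B i : set (borel E) := [set x : E | phi n x = a i] in
            [/\ (0 < N)%N,
                injective a,
                forall i, measurable (B i),
                trivIset [set: 'I_N] B /\ \bigcup_i B i = [set: borel E] &
                forall t w, iota (Xn n (t, w)) =
                  \sum_(i < N) (\1_(B i) (X (t, w)) : R) *: iota (a i)] &
          forall t w,
            [/\ forall k, mdist (Xn k (t, w)) x0 <= mdist (X (t, w)) x0,
                forall k, mdist (Xn k.+1 (t, w)) (X (t, w))
                          <= mdist (Xn k (t, w)) (X (t, w)) &
                Xn n (t, w) @[n --> \oo] --> X (t, w)]].
Proof.
have [c c_approx] := dense_admissible iota_inj E_separable E_star dist_star.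
pose phi := nearest_admissible x0 c.
have mphi n : measurable_fun [set: borel E] (phi n : borel E -> borel E).
  exact: measurable_nearest_admissible.
exists phi; split.
  split=> //.
  - exact: finite_range_nearest_admissible.
  - exact: nearest_admissible_center.
  - exact: nearest_admissible_closer.
  - exact: cvg_nearest_admissible.
move=> X mX Xn; split.
- move=> n; exact: (measurableT_comp (mphi n) mX).
- move=> n.
  (* Here [x0] witnesses that [E] is nonempty, whence [N > 0]. *)
  have [N [a [N0 inj_a aP]]] :=
    finite_range_level_sets x0 (finite_range_nearest_admissible x0 c n).
  exists N, a => B; split=> //.
  + move=> i; rewrite -[B i]setTI; apply: (mphi n measurableT [set a i]).
    exact: measurable_borel_set1.
  + split.
      move=> i j _ _ [x [Bi Bj]]; apply: inj_a.
      by rewrite -[LHS]Bi -[RHS]Bj.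
    by apply/seteqP; split=> // x _; have [i xi] := aP x; exists i.
  + move=> t w; have [i Xi] := aP (X (t, w)).
    (* Only the term of the attained value [a i] survives: a second nonzero indicator would
       contradict the injectivity of [a]. *)
    rewrite (bigD1 i)//= big1 ?addr0 => [|j ji].
      by rewrite indicE mem_set// scale1r /Xn /phi Xi.
    rewrite indicE memNset ?scale0r// => Bj.
    by move/eqP: ji; apply; apply: inj_a; rewrite -Xi -[LHS]Bj.
- move=> t w; split.
  + by move=> k; exact: nearest_admissible_center.
  + by move=> k; exact: nearest_admissible_closer.
  + exact: cvg_nearest_admissible.
Qed.
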